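(* Let $\mathcal I$ be a three-dimensional cyclic matching instance with complete preference lists and $n$ agents per class that is derived from a $2$-master list. If $n\ge 5$, then $\mathcal I$ admits no popular matching.
   Context: A three-dimensional cyclic matching instance with complete lists consists of three pairwise disjoint finite sets (agent classes) $A,B,C$ with $|A|=|B|=|C|=n$. Each agent in $A$ (resp. $B$, resp. $C$) has a strict preference list ranking all agents in $B$ (resp. $C$, resp. $A$); $\succ_x$ denotes the strict order of agent $x$, $y\succ_x z$ meaning that $x$ prefers $y$ to $z$. By convention $x$ itself is placed at the end of $\succ_x$ (being unmatched is worst). Let $V=A\cup B\cup C$. A matching $M$ is a subset of $A\times B\times C$ such that each agent appears in at most one triple. If $(a,b,c)\in M$, write $M(a)=b$, $M(b)=c$, $M(c)=a$; if $x$ is in no triple of $M$, then $M(x)=x$. For matchings $M',M$ and an agent $x$, let $\mathrm{vote}_x(M',M)=1$ if $M'(x)\succ_x M(x)$, $0$ if $M'(x)=M(x)$, and $-1$ if $M(x)\succ_x M'(x)$. $M'$ is more popular than $M$ if $\sum_{x\in V}\mathrm{vote}_x(M',M)\ge 1$. $M$ is popular if no matching is more popular than $M$. The preferences of an agent class are derived from a master list if there is a single strict order (of the agents of the class it ranks) from which the preference list of each agent in the class is obtained by deleting some agents; with complete lists this means that all agents in the class have the same preference list. An instance is derived from a $k$-master list ($k\in\{1,2,3\}$) if the preferences of $k$ of the three agent classes are each derived from a master list. *)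

(* Defs.v *)
From HB Require Import structures.
From mathcomp Require Import all_boot all_order all_algebra.

Set Implicit Arguments.
Unset Strict Implicit.
Unset Printing Implicit Defensive.

(* Lists are read from most to least preferred. *)
Definition complete_list (T : finType) (s : seq T) : Prop :=
  uniq s /\ forall x : T, x \in s.

Record cyclic_instance (A B C : finType) := CyclicInstance {
  listA : A -> seq B;
  listB : B -> seq C;
  listC : C -> seq A;
  listA_complete : forall a, complete_list (listA a);
  listB_complete : forall b, complete_list (listB b);
  listC_complete : forall c, complete_list (listC c) }.

Section Matchings.

Variables A B C : finType.

(* The disjoint union of the three classes. *)
Definition agent : finType := (A + B + C)%type.

Definition inA (a : A) : agent := inl (inl a).
Definition inB (b : B) : agent := inl (inr b).
Definition inC (c : C) : agent := inr c.

Variable I : cyclic_instance A B C.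

(* An agent closes its own list: being unmatched is the worst outcome. *)
Definition pref_list (x : agent) : seq agent :=
  rcons (match x with
         | inl (inl a) => map inB (listA I a)
         | inl (inr b) => map inC (listB I b)
         | inr c => map inA (listC I c)
         end) x.

(* [index] sends an absent item past the end of the list, so this is the order
   of agent x only on members of [pref_list x]; the values [partner M x] below
   are always such members. *)
Definition prefers (x y z : agent) : bool :=
  index y (pref_list x) < index z (pref_list x).

Definition triple : finType := (A * B * C)%type.

Definition in_triple (x : agent) (t : triple) : bool :=
  let: (a, b, c) := t in [|| x == inA a, x == inB b | x == inC c].

Definition matching (M : {set triple}) : Prop :=
  forall x : agent, #|[set t in M | in_triple x t]| <= 1.

Definition succ_in_triple (x : agent) (t : triple) : agent :=
  let: (a, b, c) := t in
  match x with
  | inl (inl _) => inB b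
  | inl (inr _) => inC c
  | inr _ => inA a
  end.

(* M(x); the picked triple is unique when M is a matching. *)
Definition partner (M : {set triple}) (x : agent) : agent :=
  if [pick t in M | in_triple x t] is Some t then succ_in_triple x t else x.

Definition vote (x : agent) (M' M : {set triple}) : int :=
  if prefers x (partner M' x) (partner M x) then 1%R
  else if prefers x (partner M x) (partner M' x) then (-1)%R
  else 0%R.

Definition more_popular (M' M : {set triple}) : Prop :=
  (1 <= \sum_(x : agent) vote x M' M)%R.

Definition popular (M : {set triple}) : Prop :=
  matching M /\ forall M' : {set triple}, matching M' -> ~ more_popular M' M.

End Matchings.

Definition from_master_list (S T : finType) (l : S -> seq T) : Prop :=
  exists m : seq T, complete_list m /\ forall x : S, subseq (l x) m.

(* The classes A, B, C are numbered 0, 1, 2. *)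
Definition class_from_master_list (A B C : finType)
    (I : cyclic_instance A B C) (i : 'I_3) : Prop :=
  match val i with
  | 0 => from_master_list (listA I)
  | 1 => from_master_list (listB I)
  | _ => from_master_list (listC I)
  end.

Definition derived_from_k_master_list (k : nat) (A B C : finType)
    (I : cyclic_instance A B C) : Prop :=
  exists K : {set 'I_3},
    #|K| = k /\ forall i, i \in K -> class_from_master_list I i.

(* Main.v *)
Require Import Defs.
From mathcomp Require Import all_boot all_order all_algebra.
From mathcomp Require Import zify.

(** A matching that leaves an agent unmatched misses one agent of every class,
    and adding a triple of three such agents makes it more popular.  A perfect
    matching is beaten by the following shift: in each of the two classes with a
    master list, replace every partner by its immediate predecessor in that list
    (cyclically).  All agents of such a class but one improve, so these classes
    contribute at least [n - 2] votes each, and the third class costs at most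
    [n] votes.  The total is at least [n - 4 >= 1]. *)

Set Implicit Arguments.
Unset Strict Implicit.
Unset Printing Implicit Defensive.

Import Order.TTheory GRing.Theory Num.Theory.

(** * Votes within one class *)

Section Score.

Variables S T : finType.
Implicit Types (l : S -> seq T) (f : S -> T).

Definition list_vote (s : seq T) (y z : T) : int :=
  if index y s < index z s then 1%R
  else if index z s < index y s then (-1)%R else 0%R.

Definition score l f' f : int := (\sum_(x : S) list_vote (l x) (f' x) (f x))%R.

Lemma score_ge l f' f : (- #|S|%:Z <= score l f' f)%R.
Proof.
rewrite -natz -sumr_const -sumrN; apply: ler_sum => x _.
by rewrite /list_vote; case: ifP => // _; case: ifP.
Qed.

(** Two complete lists have the same length, and a subsequence as long as the whole list is the
    whole list. *)
Lemma master_listE l : (forall x, complete_list (l x)) -> from_master_list l ->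
  exists2 m, complete_list m & forall x, l x = m.
Proof.
move=> lC [m [[Um mT] lm]]; exists m => // x.
have [Ul lT] := lC x.
apply/eqP; rewrite -(size_subseq_leqif (lm x)).
by apply/eqP/perm_size/uniq_perm => // y; rewrite lT mT.
Qed.

(** [prev] is cyclic and sends the head to the last item, hence the exception. Any other item lies
    in the tail, and its index in the tail is the index of its predecessor in the full list. *)
Lemma index_prev (m : seq T) y0 (y : T) : uniq m -> y \in m ->
  y != head y0 m -> index (prev m y) m < index y m.
Proof.
case: m => // z m Um ym; rewrite [head _ _]/= => yz.
have ym' : y \in m by move: ym; rewrite inE (negPf yz).
rewrite prev_nth ym index_uniq //=; last by rewrite ltnW // ltnS index_mem.
by rewrite [z == y]eq_sym (negPf yz).
Qed.

Lemma score_prev l f m : complete_list m -> (forall x, l x = m) ->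
  injective f -> (#|S|%:Z - 2 <= score l (prev m \o f) f)%R.
Proof.
move=> [Um mT] lm f_inj.
(* [head] needs a default value, so an empty class is treated apart. *)
have [x0 _|S0] := pickP (@predT S); last first.
  by rewrite /score big_pred0 ?(eq_card0 S0).
pose y0 := head (f x0) m.
have -> : (#|S|%:Z = \sum_(x : S) 1)%R by rewrite sumr_const natz.
(* Compared with a vote of 1 from everybody, only an agent matched to the head of [m] can fall
   short, by at most 2. Injectivity of [f] leaves at most one such agent. *)
have le2 : (\sum_(x : S) (if f x == y0 then 2%:Z else 0) <= 2)%R.
  rewrite -big_mkcond /= sumr_const.
  have : #|[pred x | f x == y0]| <= 1.
    by apply/card_le1P => x /eqP fx y; rewrite !inE -fx (inj_eq f_inj).
  by case: #|_| => [|[|]].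
apply: le_trans (lerB (lexx _) le2) _.
rewrite -sumrB; apply: ler_sum => x _.
rewrite lm /list_vote; case: ifPn => [_|fx].
  by case: ifP => // _; case: ifP.
by rewrite (index_prev Um (mT _) fx).
Qed.

End Score.

(** * Perfect matchings as cycles of bijections *)

Section Cycles.

Variables A B C : finType.

(** These are the partner functions of a perfect matching: following them once around the three
    classes leads back to the start. Stating this from each class makes the notion invariant under
    rotation. *)
Definition cyclic_inverses (f : A -> B) (g : B -> C) (h : C -> A) :=
  [/\ cancel (g \o f) h, cancel (h \o g) f & cancel (f \o h) g].

Lemma cyclic_inverses_inj f g h : cyclic_inverses f g h ->
  [/\ injective f, injective g & injective h].
Proof.
case=> fK gK hK; split.
- exact: inj_compr (can_inj fK).
- exact: inj_compr (can_inj gK).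
- exact: inj_compr (can_inj hK).
Qed.

(** Injections between classes of equal size are bijections, so the third function is the inverse of
    the composite. Partners in two classes can thus be chosen freely, and the third class
    follows. *)
Lemma cyclic_inverses_complete f g : #|A| = #|B| -> #|B| = #|C| ->
  injective f -> injective g -> exists h, cyclic_inverses f g h.
Proof.
move=> AB BC fI gI.
have [|f' fK f'K] := inj_card_bij fI; first by rewrite AB.
have [|g' gK g'K] := inj_card_bij gI; first by rewrite BC.
exists (f' \o g'); split=> x /=; first by rewrite gK fK.
  by rewrite gK f'K.
by rewrite f'K g'K.
Qed.

End Cycles.

Lemma cyclic_inverses_rot (A B C : finType) (f : A -> B) (g : B -> C)
    (h : C -> A) : cyclic_inverses f g h -> cyclic_inverses g h f.
Proof. by case. Qed.

Lemma inj_prev (T : finType) (m : seq T) : uniq m -> injective (prev m).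
Proof. by move=> Um; apply: can_inj (next_prev Um). Qed.

(** * Partners in a matching and votes *)

Section Matchings.

Variables A B C : finType.
Implicit Types (M : {set triple A B C}) (x : agent A B C) (t : triple A B C).

Lemma in_triple_inj M x t t' : matching M -> t \in M -> t' \in M ->
  in_triple x t -> in_triple x t' -> t = t'.
Proof.
move=> /(_ x)/card_le1_eqP MM tM t'M xt xt'.
by apply: MM; rewrite inE ?tM ?t'M.
Qed.

Lemma in_tripleA t : in_triple (inA B C t.1.1) t.
Proof. by case: t => [[a b] c] /=; rewrite eqxx. Qed.

Lemma in_tripleB t : in_triple (inB A C t.1.2) t.
Proof. by case: t => [[a b] c] /=; rewrite eqxx. Qed.

Lemma in_tripleC t : in_triple (inC A B t.2) t.
Proof. by case: t => [[a b] c] /=; rewrite eqxx. Qed.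

Lemma partner_in M x t : matching M -> t \in M -> in_triple x t ->
  partner M x = succ_in_triple x t.
Proof.
move=> MM tM xt; rewrite /partner; case: pickP => [t' /andP[t'M xt']|/(_ t)].
  by rewrite (in_triple_inj MM tM t'M xt xt').
by rewrite /= tM xt.
Qed.

Lemma partner_out M x : (forall t, t \in M -> ~~ in_triple x t) ->
  partner M x = x.
Proof.
move=> Mx; rewrite /partner; case: pickP => // t /andP[tM].
by rewrite (negPf (Mx t tM)).
Qed.

Variable I : cyclic_instance A B C.

Lemma prefersA a b b' : prefers I (inA B C a) (inB A C b) (inB A C b') =
  (index b (listA I a) < index b' (listA I a)).
Proof.
have inj : injective (@inB A B C) by move=> ? ? [].
have [_ lT] := listA_complete I a.
by rewrite /prefers /pref_list /= -cats1 !index_cat !mem_map // !lT !index_map.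
Qed.

Lemma prefersB b c c' : prefers I (inB A C b) (inC A B c) (inC A B c') =
  (index c (listB I b) < index c' (listB I b)).
Proof.
have inj : injective (@inC A B C) by move=> ? ? [].
have [_ lT] := listB_complete I b.
by rewrite /prefers /pref_list /= -cats1 !index_cat !mem_map // !lT !index_map.
Qed.

Lemma prefersC c a a' : prefers I (inC A B c) (inA B C a) (inA B C a') =
  (index a (listC I c) < index a' (listC I c)).
Proof.
have inj : injective (@inA A B C) by move=> ? ? [].
have [_ lT] := listC_complete I c.
by rewrite /prefers /pref_list /= -cats1 !index_cat !mem_map // !lT !index_map.
Qed.

Lemma prefers_unmatched x t : in_triple x t ->
  prefers I x (succ_in_triple x t) x.
Proof.
case: t => [[a b] c] _; rewrite /prefers /pref_list -cats1 !index_cat.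
have inA_inj : injective (@inA A B C) by move=> ? ? [].
have inB_inj : injective (@inB A B C) by move=> ? ? [].
have inC_inj : injective (@inC A B C) by move=> ? ? [].
case: x => [[a'|b']|c'] /=.
- have [_ lT] := listA_complete I a'; rewrite mem_map // lT ifN.
    by rewrite ltn_addr // index_mem mem_map.
  by apply/negP => /mapP[].
- have [_ lT] := listB_complete I b'; rewrite mem_map // lT ifN.
    by rewrite ltn_addr // index_mem mem_map.
  by apply/negP => /mapP[].
- have [_ lT] := listC_complete I c'; rewrite mem_map // lT ifN.
    by rewrite ltn_addr // index_mem mem_map.
  by apply/negP => /mapP[].
Qed.

Lemma add_triple_more_popular M a b c : matching M ->
    (forall t, t \in M -> [&& t.1.1 != a, t.1.2 != b & t.2 != c]) ->
  exists2 M', matching M' & more_popular I M' M.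
Proof.
move=> MM Mabc; set t0 : triple A B C := (a, b, c).
have out x t : in_triple x t0 -> t \in M -> ~~ in_triple x t.
  move=> xt0 /Mabc; case: t => [[a' b'] c'] /= /and3P[/eqP aa /eqP bb /eqP cc].
  apply/negP; case/or3P: xt0 => /eqP -> /or3P[] /eqP // [] /esym.
  - exact: aa.
  - exact: bb.
  - exact: cc.
pose M' := t0 |: M.
have MM' : matching M'.
  move=> x; case: (boolP (in_triple x t0)) => [xt0|nxt0].
    apply/card_le1_eqP => t t'; rewrite !inE.
    move=> /andP[/orP[/eqP->|tM] xt]; last first.
      by case/negP: (out x t xt0 tM).
    move=> /andP[/orP[/eqP->//|tM] xt'].
    by case/negP: (out x t' xt0 tM).
  apply: leq_trans (MM x); apply/subset_leq_card/subsetP => t.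
  rewrite !inE => /andP[/orP[/eqP->|->->//]].
  by rewrite (negPf nxt0).
exists M' => //; rewrite /more_popular.
have t0M' : t0 \in M' by rewrite setU11.
have vote_in x : in_triple x t0 -> vote I x M' M = 1%R.
  move=> xt0; rewrite /vote (partner_in MM' t0M' xt0).
  by rewrite (@partner_out M) ?prefers_unmatched // => t; apply: out.
have vote_ge0 x : (0 <= vote I x M' M)%R.
  have [/vote_in -> //|nxt0] := boolP (in_triple x t0).
  (* An agent outside the new triple keeps its partner, or stays unmatched, and so votes 0. *)
  suff e : partner M' x = partner M x by rewrite /vote e /prefers ltnn.
  have [/existsP[t /andP[tM xt]]|/existsPn nM] :=
      boolP [exists t in M, in_triple x t].
    have tM' : t \in M' by rewrite setU1r.
    by rewrite (partner_in MM tM xt) (partner_in MM' tM' xt).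
  have nM1 t : t \in M -> ~~ in_triple x t.
    by move=> tM; have := nM t; rewrite tM.
  rewrite !partner_out // => t.
  by rewrite in_setU1 => /orP[/eqP->//|/nM1].
(* The vote of [a] alone gives the required 1, since no vote is negative. *)
rewrite (bigD1 (inA B C a)) //= vote_in ?(in_tripleA t0) //.
by rewrite lerDl; apply: sumr_ge0.
Qed.

(** * Perfect matchings and their votes *)

Definition cycle_matching (f : A -> B) (g : B -> C) : {set triple A B C} :=
  [set (a, f a, g (f a)) | a in [set: A]].

Section CycleMatching.

Variables (f : A -> B) (g : B -> C) (h : C -> A).
Hypothesis fgh : cyclic_inverses f g h.

Lemma cycle_matchingP : matching (cycle_matching f g).
Proof.
have [f_inj g_inj _] := cyclic_inverses_inj fgh.
move=> x; apply/card_le1_eqP => t t'; rewrite !inE.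
move=> /andP[/imsetP[a _ ->] xa] /andP[/imsetP[a' _ ->] xa'].
suff -> : a = a' by [].
case/or3P: xa xa' => /eqP -> /or3P[] /eqP // [].
- by [].
- exact: f_inj.
- by move=> /g_inj; apply: f_inj.
Qed.

Lemma mem_cycle_matching a : (a, f a, g (f a)) \in cycle_matching f g.
Proof. exact: imset_f. Qed.

Lemma partner_cycleA a :
  partner (cycle_matching f g) (inA B C a) = inB A C (f a).
Proof.
by rewrite (partner_in cycle_matchingP (mem_cycle_matching a)) //= eqxx.
Qed.

Lemma partner_cycleB b :
  partner (cycle_matching f g) (inB A C b) = inC A B (g b).
Proof.
have [_ gK _] := fgh.
(* The triple through [b] starts at [h (g b)], because [f] sends that agent back to [b]. *)
have := mem_cycle_matching (h (g b)); rewrite [f _]gK => tM.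
by rewrite (partner_in cycle_matchingP tM) //= eqxx.
Qed.

Lemma partner_cycleC c :
  partner (cycle_matching f g) (inC A B c) = inA B C (h c).
Proof.
have [_ _ hK] := fgh.
have := mem_cycle_matching (h c); rewrite [g _]hK => tM.
by rewrite (partner_in cycle_matchingP tM) //= eqxx !orbT.
Qed.

End CycleMatching.

Lemma sum_vote_cycle f g h f' g' h' :
    cyclic_inverses f g h -> cyclic_inverses f' g' h' ->
  (\sum_x vote I x (cycle_matching f' g') (cycle_matching f g) =
   score (listA I) f' f + score (listB I) g' g + score (listC I) h' h)%R.
Proof.
move=> fgh fgh'; rewrite !big_sumType /=; congr (_ + _ + _)%R.
- apply: eq_bigr => a _; rewrite -[inl _]/(inA B C a) /vote.
  by rewrite (partner_cycleA fgh) (partner_cycleA fgh') !prefersA.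
- apply: eq_bigr => b _; rewrite -[inl _]/(inB A C b) /vote.
  by rewrite (partner_cycleB fgh) (partner_cycleB fgh') !prefersB.
- apply: eq_bigr => c _; rewrite -[inr _]/(inC A B c) /vote.
  by rewrite (partner_cycleC fgh) (partner_cycleC fgh') !prefersC.
Qed.

(** The case distinction is on cardinals rather than on surjectivity of [p], so that for classes of
    equal size the three projections fall into the same case together. *)
Lemma proj_onto_or_missed (T : finType) (p : triple A B C -> T) M :
    {in M &, injective p} ->
  if #|M| == #|T| then forall y, exists2 t, t \in M & p t = y
  else exists y, forall t, t \in M -> p t != y.
Proof.
move=> p_inj; rewrite -(card_in_imset p_inj); case: ifP => [/eqP e y|e].
  have /imsetP[t tM ->] : y \in p @: M.
    suff -> : p @: M = setT by rewrite inE.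
    by apply/eqP; rewrite eqEcard subsetT cardsT e leqnn.
  by exists t.
have /existsP[y yM] : [exists y, y \notin p @: M].
  rewrite -negb_forall; apply: contraFN e => /forallP all.
  suff -> : p @: M = setT by rewrite cardsT.
  by apply/setP => y; rewrite inE all.
exists y => t tM; apply: contraNneq yM => <-; exact: imset_f.
Qed.

Lemma perfect_or_extendable M : #|A| = #|B| -> #|B| = #|C| -> matching M ->
  (exists f g h, cyclic_inverses f g h /\ M = cycle_matching f g) \/
  exists a b c, forall t, t \in M -> [&& t.1.1 != a, t.1.2 != b & t.2 != c].
Proof.
move=> AB BC MM.
have eqA t t' : t \in M -> t' \in M -> t.1.1 = t'.1.1 -> t = t'.
  move=> tM t'M e; apply: (in_triple_inj MM tM t'M (in_tripleA t)).
  by rewrite e; apply: in_tripleA.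
have eqB t t' : t \in M -> t' \in M -> t.1.2 = t'.1.2 -> t = t'.
  move=> tM t'M e; apply: (in_triple_inj MM tM t'M (in_tripleB t)).
  by rewrite e; apply: in_tripleB.
have eqC t t' : t \in M -> t' \in M -> t.2 = t'.2 -> t = t'.
  move=> tM t'M e; apply: (in_triple_inj MM tM t'M (in_tripleC t)).
  by rewrite e; apply: in_tripleC.
have := proj_onto_or_missed eqA; have := proj_onto_or_missed eqB.
(* After rewriting the cardinals, all three statements test the same condition, and a single case
   analysis decides them. *)
have := proj_onto_or_missed eqC; rewrite AB BC; case: ifP => _; last first.
  move=> [c Mc] [b Mb] [a Ma]; right; exists a, b, c => t tM.
  by rewrite Ma ?Mb ?Mc.
move=> /fin_all_exists2[tC tCM tCE] /fin_all_exists2[tB tBM tBE].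
move=> /fin_all_exists2[tA tAM tAE].
left; exists (fun a => (tA a).1.2), (fun b => (tB b).2), (fun c => (tC c).1.1).
(* The triples that [tA], [tB], [tC] select for members of one triple of [M] coincide, since triples
   of [M] with a common agent are equal. *)
have tBA a : tB (tA a).1.2 = tA a by apply: eqB.
have tCB b : tC (tB b).2 = tB b by apply: eqC.
have tAC c : tA (tC c).1.1 = tC c by apply: eqA.
split; first split.
- by move=> a /=; rewrite tCB tBA tAE.
- by move=> b /=; rewrite tAC tCB tBE.
- by move=> c /=; rewrite tBA tAC tCE.
apply/setP => t; apply/idP/imsetP => [tM|[a _ ->]].
  exists t.1.1 => //; have -> : tA t.1.1 = t by apply: eqA.
  by have -> : tB t.1.2 = t; [apply: eqB | case: t {tM} => [[]]].
by rewrite tBA -{1}(tAE a) -!surjective_pairing.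
Qed.

End Matchings.

(** If no two elements of [K] were cyclically consecutive, [K] and its image under the injective
    [ordS] would be disjoint, giving 4 elements in a set of 3. Consecutive classes let the final
    case analysis run through the rotations of one argument. *)
Lemma two_of_three (K : {set 'I_3}) (P : 'I_3 -> Prop) :
    #|K| = 2 -> (forall i, i \in K -> P i) ->
  exists2 i, P i & P (ordS i).
Proof.
move=> K2 KP.
suff /existsP[i /andP[/KP Pi /KP PSi]] : [exists i, (i \in K) && (ordS i \in K)].
  by exists i.
apply: contraT => /existsPn nK.
have disj : [disjoint K & @ordS 3 @: K].
  apply/pred0P => j /=; apply/andP => -[jK /imsetP[i iK ej]].
  by have := nK i; rewrite iK -ej jK.
have := max_card (K :|: @ordS 3 @: K).
rewrite cardsU disjoint_setI0 // cards0 subn0 (card_imset _ (@ordS_inj 3)).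
by rewrite K2 card_ord.
Qed.

(** * Every matching is beaten *)

Theorem theorem8 (n : nat) (A B C : finType)
    (cardA : #|A| = n) (cardB : #|B| = n) (cardC : #|C| = n)
    (I : cyclic_instance A B C)
    (master : derived_from_k_master_list 2 I)
    (n_ge5 : 5 <= n) :
  ~ exists M : {set triple A B C}, popular I M.
Proof.
case=> M [MM Mpop].
have AB : #|A| = #|B| by rewrite cardA.
have BC : #|B| = #|C| by rewrite cardB.
have CA : #|C| = #|A| by rewrite cardC.
have [[f [g [h [fgh eM]]]]|[a [b [c Mabc]]]] := perfect_or_extendable AB BC MM;
  last first.
  by have [M' MM'] := add_triple_more_popular I MM Mabc; apply: Mpop.
have [f_inj g_inj h_inj] := cyclic_inverses_inj fgh.
have beat f' g' h' : cyclic_inverses f' g' h' ->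
    ~ (1 <= score (listA I) f' f + score (listB I) g' g
          + score (listC I) h' h)%R.
  move=> fgh'; rewrite -(sum_vote_cycle _ fgh fgh') -eM.
  exact: Mpop (cycle_matchingP fgh').
have [K [K2 KP]] := master.
have listAE := master_listE (listA_complete I).
have listBE := master_listE (listB_complete I).
have listCE := master_listE (listC_complete I).
have [i] := two_of_three K2 KP.
case: i => [[|[|[|//]]] lti] /=.
- move=> /listAE[m mC lm] /listBE[m' mC' lm'].
  (* The partners in the two master-list classes are shifted; those in the third class are whatever
     [h'] they force, so only the trivial bound [score_ge] is available there. *)
  have [||h' fgh'] := cyclic_inverses_complete AB BC (f := prev m \o f)
    (g := prev m' \o g).
  + by apply: inj_comp f_inj; apply: inj_prev; case: mC.
  + by apply: inj_comp g_inj; apply: inj_prev; case: mC'.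
  apply: (beat _ _ _ fgh').
  have := score_prev mC lm f_inj; have := score_prev mC' lm' g_inj.
  have := score_ge (listC I) h' h; lia.
- move=> /listBE[m mC lm] /listCE[m' mC' lm'].
  have [||h' fgh'] := cyclic_inverses_complete BC CA (f := prev m \o g)
    (g := prev m' \o h).
  + by apply: inj_comp g_inj; apply: inj_prev; case: mC.
  + by apply: inj_comp h_inj; apply: inj_prev; case: mC'.
  (* This cycle was built starting from [B]; two rotations make it start from [A], as [beat]
     expects. *)
  apply: (beat _ _ _ (cyclic_inverses_rot (cyclic_inverses_rot fgh'))).
  have := score_prev mC lm g_inj; have := score_prev mC' lm' h_inj.
  have := score_ge (listA I) h' f; lia.
- move=> /listCE[m mC lm] /listAE[m' mC' lm'].
  have [||h' fgh'] := cyclic_inverses_complete CA AB (f := prev m \o h)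
    (g := prev m' \o f).
  + by apply: inj_comp h_inj; apply: inj_prev; case: mC.
  + by apply: inj_comp f_inj; apply: inj_prev; case: mC'.
  (* Here the cycle starts from [C], so one rotation suffices. *)
  apply: (beat _ _ _ (cyclic_inverses_rot fgh')).
  have := score_prev mC lm h_inj; have := score_prev mC' lm' f_inj.
  have := score_ge (listB I) h' g; lia.
Qed.
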